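(* Let $A$ be an $n\times n$ symmetric positive semi-definite matrix. Given a pair $(\varepsilon,\delta)$ of small (say, $<1$) positive values, the inequality $$\Pr\left(\,|tr_H^N(A)-tr(A)|\le \varepsilon\, tr(A)\,\right)\ \ge\ 1-\delta$$ holds if $N$ satisfies $$N\ \ge\ 6\,c(\varepsilon,\delta),\qquad c(\varepsilon,\delta):=\varepsilon^{-2}\ln(2/\delta).$$
   Context: Matrices are real-valued, and $tr(A)$ denotes the trace of $A$. The Hutchinson trace estimator with sample size $N$ is $tr_H^N(A):=\frac1N\sum_{i=1}^N w_i^t A w_i$, where $w_1,\dots,w_N\in\mathbb{R}^n$ are independent random vectors, $w_i=(w_{i1},\dots,w_{in})^t$, whose components are i.i.d. Rademacher random variables: $\Pr(w_{ij}=1)=\Pr(w_{ij}=-1)=\tfrac12$.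
   Formalization: ''Small (say, <1)'' is taken as ε ≤ 3/4 (δ still ranges over (0,1)), since with constant 6 the claim fails for ε near 1: for A the all-ones matrix divided by n, n large, ε = 0.99, N = 1000 and N = 6c(ε,δ), the upper tail alone exceeds δ. *)

(* Defs.v *)
From mathcomp Require Export all_boot all_order all_algebra.
From mathcomp Require Export all_classical all_reals all_analysis.
Export Order.TTheory GRing.Theory Num.Theory.
Export numFieldNormedType.Exports.

Set Implicit Arguments.
Unset Strict Implicit.
Unset Printing Implicit Defensive.

Local Open Scope classical_set_scope.
Local Open Scope ring_scope.

Definition psdmx (R : realType) (n : nat) (A : 'M[R]_n) : Prop :=
  A^T = A /\ forall v : 'cV[R]_n, 0 <= (v^T *m A *m v) 0 0.

Definition mutually_independent (R : realType) (d : measure_display)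
    (T : measurableType d) (P : probability T R) (I : finType)
    (F : I -> set (set T)) : Prop :=
  forall (J : {set I}) (E : I -> set T),
    (forall i, i \in J -> F i (E i)) ->
    P (\bigcap_(i in [set` J]) E i) = (\prod_(i in J) P (E i))%E.

Definition rademacher (R : realType) (d : measure_display)
    (T : measurableType d) (P : probability T R) (X : {RV P >-> R}) : Prop :=
  P (X @^-1` [set 1]) = (2^-1)%:E /\ P (X @^-1` [set -1]) = (2^-1)%:E.

(* [w i j] is the j-th component of the i-th random vector. Independence of
   the vectors is independence of the sigma-algebras that each of them
   generates; [g_sigma_preimage (fun j => w i j)] is the one generated by the
   vector [w i]. *)
Definition rademacher_sample (R : realType) (d : measure_display)
    (T : measurableType d) (P : probability T R) (n N : nat)
    (w : 'I_N -> 'I_n -> {RV P >-> R}) : Prop :=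
  [/\ mutually_independent P
        (fun i => g_sigma_preimage (fun j => w i j : T -> R)),
      forall i, mutually_independent P
        (fun j => g_sigma_algebra_preimage (w i j : T -> R)) &
      forall i j, rademacher (w i j)].

Definition sample_vector (R : realType) (d : measure_display)
    (T : measurableType d) (P : probability T R) (n N : nat)
    (w : 'I_N -> 'I_n -> {RV P >-> R}) (i : 'I_N) (x : T) : 'cV[R]_n :=
  \col_j w i j x.

Definition hutchinson (R : realType) (d : measure_display)
    (T : measurableType d) (P : probability T R) (n N : nat)
    (w : 'I_N -> 'I_n -> {RV P >-> R}) (A : 'M[R]_n) (x : T) : R :=
  N%:R^-1 * \sum_(i < N)
    ((sample_vector w i x)^T *m A *m sample_vector w i x) 0 0.

Definition sample_bound (R : realType) (eps delta : R) : R :=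
  eps ^- 2 * ln (2 / delta).

(* Main.v *)
Require Import Defs.
From mathcomp Require Import ring lra measurable_realfun.

Set Implicit Arguments.
Unset Strict Implicit.
Unset Printing Implicit Defensive.

Local Open Scope classical_set_scope.
Local Open Scope ring_scope.

(** The sample takes, up to a null set, only finitely many values: independence
    gives each N x n sign matrix the probability 2^-(nN), so the theorem is
    about counting sign matrices, and probabilities become uniform means over
    finite cubes ([probability_sample_event], [probability_ge_mean]).

    For one sign vector s write X(s) = s^T A s / tr A. Chernoff's method
    ([chernoff]) bounds each tail of the average of N copies of X by the N-th
    power of the mean of exp(h(X - (1+eps))), resp. exp(h((1-eps) - X)). Both
    means are at most exp(-eps^2/6) for a suitable h ([upper_tail_mgf],
    [lower_tail_mgf]), and N >= 6 eps^-2 ln(2/delta) makes the N-th power at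
    most delta/2.

    To bound these means, A is written as a sum of matrices v v^T
    ([psd_sum_outer]). Then X is a convex combination, with weights
    |v|^2 / tr A, of the variables (v.s)^2 / |v|^2, and by Jensen it suffices to
    treat one linear form u.s with |u| = 1 ([mgf_ratio]).

    A Rademacher sum is dominated by a standard Gaussian g in two ways. First,
    mean exp(h (u.s)^2) <= E exp(h g^2) = (1-2h)^(-1/2) ([mgf_signed_sum_sqr]);
    with h = eps/(2(1+eps)) the upper tail reduces to
    1+eps <= exp(eps - eps^2/3), which is where eps <= 3/4 is used
    ([onePx_le_expR]). Second, mean (u.s)^4 <= E g^4 = 3
    ([mean_signed_sum_exp4]); with exp(-y) <= 1 - y + y^2/2 and h = eps/3 this
    gives the lower tail. No Gaussian integral appears: both comparisons go by
    induction on the number of signs, averaging over one sign at a time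
    ([mean_signed_sum_cons]). *)

(** * Inequalities for the exponential *)

Section ExpBounds.
Variable R : realType.
Implicit Types x y h : R.

Lemma expR_ge_series x n : 0 <= x -> series (exp_coeff x) n <= expR x.
Proof.
move=> x0; apply: nondecreasing_cvgn_le; last exact: is_cvg_series_exp_coeff.
by apply: nondecreasing_series => i _ _; exact: exp_coeff_ge0.
Qed.

Lemma exp_even_coeff_le y k :
  exp_coeff y k.*2 <= exp_coeff (y ^+ 2 / 2) k.
Proof.
rewrite /exp_coeff /= exprMn exprVn -exprM mul2n -mulrA.
apply: ler_wpM2l; first by rewrite -mul2n exprM exprn_ge0 // sqr_ge0.
rewrite -invfM lef_pV2 ?posrE ?mulr_gt0 ?exprn_gt0 ?ltr0n ?fact_gt0 //.
rewrite -natrX -natrM ler_nat; elim: k => // k IHk.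
rewrite expnS (factS k) doubleS !factS mulnACA.
have -> : (2 * k.+1 = k.*2.+2)%N by rewrite -doubleS -mul2n.
rewrite leq_mul2l /=; apply: leq_trans IHk _; exact: leq_pmull.
Qed.

(** Termwise comparison of the two power series: the odd terms of exp y and
    exp (- y) cancel. *)
Lemma cosh_le_expR y : expR y + expR (- y) <= 2 * expR (y ^+ 2 / 2).
Proof.
have even_sum m : series (exp_coeff y) m.*2 + series (exp_coeff (- y)) m.*2
    <= 2 * series (exp_coeff (y ^+ 2 / 2)) m.
  rewrite /series /= -big_split /=; elim: m => [|m IHm].
    by rewrite !big_geq // mulr0.
  rewrite doubleS !big_nat_recr //= mulrDr -addrA lerD //.
  have -> : exp_coeff (- y) m.*2 = exp_coeff y m.*2.
    by rewrite /exp_coeff /= exprNn -mul2n exprM sqrrN expr1n expr1n mul1r.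
  have -> : exp_coeff (- y) m.*2.+1 = - exp_coeff y m.*2.+1.
    rewrite /exp_coeff /= exprNn -signr_odd /= odd_double /=.
    by rewrite expr1 mulN1r mulNr.
  by have := exp_even_coeff_le y m; lra.
have c : (fun m => series (exp_coeff y) m.*2 + series (exp_coeff (- y)) m.*2)
    @ \oo --> expR y + expR (- y).
  have dbl : (fun m => m.*2) @ \oo --> \oo.
    apply/cvgnyPge => M; exists M => // k /= Mk.
    by rewrite (leq_trans Mk) // -addnn leq_addr.
  apply: cvgD.
  - exact: (cvg_comp _ _ dbl (is_cvg_series_exp_coeff y)).
  - exact: (cvg_comp _ _ dbl (is_cvg_series_exp_coeff (- y))).
apply: (ler_cvg_to c (cvg_cst _)); near=> m.
apply: le_trans (even_sum m) _; rewrite ler_pM2l ?ltr0n //.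
by apply: expR_ge_series; rewrite divr_ge0 ?sqr_ge0.
Unshelve. all: by end_near.
Qed.

Lemma expR_ge_cubic x : 0 <= x -> 1 + x + x ^+ 2 / 2 + x ^+ 3 / 6 <= expR x.
Proof.
move=> x0; have e4 := expR_ge_series 4 x0; apply: le_trans e4.
rewrite /series /= !big_nat_recl // big_geq // /exp_coeff /= !factS fact0.
rewrite !expr0 expr1; lra.
Qed.

(** (1 + x + x^2/2) (1 - x + x^2/2) = 1 + x^4/4 >= 1, so the right-hand side is
    at least the inverse of 1 + x + x^2/2, which exp x dominates. *)
Lemma expRN_le_quadratic x : 0 <= x -> expR (- x) <= 1 - x + x ^+ 2 / 2.
Proof.
move=> x0; have ex := expR_ge_cubic x0.
have e1 := expRxMexpNx_1 x; have eN := expR_ge0 (- x).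
have x3 : 0 <= x ^+ 3 by exact: exprn_ge0.
have q0 : 0 < 1 + x + x ^+ 2 / 2 by nra.
rewrite -(ler_pM2l q0); apply: (@le_trans _ _ 1); nra.
Qed.

(** The bound 3/4 is nearly sharp: the inequality already fails at x = 4/5. The
    cubic Taylor polynomial of exp at x - x^2/3 is just precise enough; in the
    variable z = 1 - x/3 it leaves z^2/2 + z^3/2 - z^4/2 >= 1/3, whose left-hand
    side increases on [3/4, 1] and exceeds 1/3 by less than 0.001 at z = 3/4. *)
Lemma onePx_le_expR x : 0 <= x -> x <= 3 / 4 ->
  1 + x <= expR (x - x ^+ 2 / 3).
Proof.
move=> x0 x1; set y := x - _.
have y0 : 0 <= y by rewrite /y; nra.
apply: le_trans (expR_ge_cubic y0).
pose z := 1 - x / 3.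
have z1 : z <= 1 by rewrite /z; lra.
have z2 : 3 / 4 <= z by rewrite /z; lra.
suff H : 0 <= z ^+ 2 / 2 + z ^+ 3 / 2 - z ^+ 4 / 2 - 1 / 3.
  suff -> : 1 + y + y ^+ 2 / 2 + y ^+ 3 / 6 = 1 + x +
     x ^+ 2 * (z ^+ 2 / 2 + z ^+ 3 / 2 - z ^+ 4 / 2 - 1 / 3).
    by rewrite lerDl mulr_ge0 // sqr_ge0.
  by rewrite /y /z; field.
(* six times the increment of the polynomial between 3/4 and z *)
have : 0 <= (z - 3 / 4) * (3 * (z + 3 / 4) +
    3 * (z ^+ 2 + z * (3 / 4) + 9 / 16) -
    3 * (z ^+ 3 + z ^+ 2 * (3 / 4) + z * (9 / 16) + 27 / 64)).
  apply: mulr_ge0; first lra.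
  have : 0 <= z ^+ 2 by exact: sqr_ge0.
  have : z ^+ 3 <= z ^+ 2 by rewrite exprS ler_piMl // sqr_ge0.
  nra.
nra.
Qed.
End ExpBounds.

(** * Uniform means and Rademacher sums on the cube *)

Section Mean.
Variables (R : realType) (S : finType).
Implicit Types f g : S -> R.

Definition mean f : R := #|S|%:R^-1 * \sum_s f s.

Lemma eq_mean f g : f =1 g -> mean f = mean g.
Proof. by move=> fg; rewrite /mean (eq_bigr g). Qed.

Lemma ler_mean f g : (forall s, f s <= g s) -> mean f <= mean g.
Proof.
by move=> fg; rewrite /mean ler_wpM2l ?invr_ge0 ?ler0n // ler_sum.
Qed.

Lemma mean_cst c : (0 < #|S|)%N -> mean (fun=> c) = c.
Proof.
move=> S0; rewrite /mean sumr_const -[c *+ _]mulr_natl mulrA mulVf ?mul1r //.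
by rewrite pnatr_eq0 -lt0n.
Qed.

Lemma meanD f g : mean (fun s => f s + g s) = mean f + mean g.
Proof. by rewrite /mean big_split mulrDr. Qed.

Lemma meanZ c f : mean (fun s => c * f s) = c * mean f.
Proof. by rewrite /mean -mulr_sumr mulrCA. Qed.

Lemma mean_sum (I : Type) (r : seq I) (F : I -> S -> R) :
  mean (fun s => \sum_(i <- r) F i s) = \sum_(i <- r) mean (F i).
Proof. by rewrite /mean exchange_big mulr_sumr. Qed.

End Mean.

Section Cube.
Variables (R : realType) (I : finType).
Implicit Types (s : {ffun I -> bool}) (i j : I) (u : I -> R) (r : seq I).

Lemma card_cube_gt0 : (0 < #|{: {ffun I -> bool}}|)%N.
Proof. by apply/card_gt0P; exists [ffun=> false]. Qed.

Definition flip j s : {ffun I -> bool} := [ffun i => s i (+) (i == j)].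

Lemma flipK j : involutive (flip j).
Proof. by move=> s; apply/ffunP => i; rewrite !ffunE -addbA addbb addbF. Qed.

Definition signed_sum u r s : R := \sum_(i <- r) u i * (-1) ^+ s i.

Lemma signed_sum_nil u s : signed_sum u [::] s = 0.
Proof. exact: big_nil. Qed.

(** Flipping the sign s j preserves the uniform mean and fixes the other signs,
    so s j can be averaged out. This is the induction step of all bounds below
    on means over the cube. *)
Lemma mean_signed_sum_cons (f : R -> R) u j r : j \notin r ->
  mean (fun s => f (signed_sum u (j :: r) s)) =
  mean (fun s => (f (signed_sum u r s + u j) + f (signed_sum u r s - u j)) / 2).
Proof.
move=> jr; rewrite /mean; congr (_ * _).
have flipE s : signed_sum u (j :: r) (flip j s) =
    - (u j * (-1) ^+ s j) + signed_sum u r s.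
  rewrite /signed_sum big_cons ffunE eqxx addbT signrN mulrN; congr (_ + _).
  apply: eq_big_seq => i ir; rewrite ffunE (_ : i == j = false) ?addbF //.
  by apply/eqP => ij; rewrite ij (negbTE jr) in ir.
set F := fun s => f (signed_sum u (j :: r) s).
have -> : \sum_s F s = (\sum_s F s + \sum_s F (flip j s)) / 2.
  have -> : \sum_s F (flip j s) = \sum_s F s.
    by rewrite [RHS](reindex_inj (inv_inj (flipK j))).
  by field.
rewrite -big_split mulr_suml; apply: eq_bigr => s _; congr (_ / 2).
rewrite /F flipE /signed_sum big_cons.
case: (s j); rewrite ?expr0 ?expr1 ?mulr1 ?mulrN1 ?opprK [in RHS]addrC //.
  by congr (f _ + f _); rewrite addrC.
by rewrite addrC; congr (f _ + f _); rewrite addrC.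
Qed.

Lemma mean_signed_sum_sqr u r : uniq r ->
  mean (fun s => signed_sum u r s ^+ 2) = \sum_(i <- r) u i ^+ 2.
Proof.
elim: r => [_|j r IHr /= /andP[jr ur]].
  under eq_mean do rewrite signed_sum_nil.
  by rewrite big_nil mean_cst ?card_cube_gt0 // expr0n.
rewrite (mean_signed_sum_cons (fun x => x ^+ 2)) // big_cons -IHr //.
rewrite -[u j ^+ 2](mean_cst _ card_cube_gt0) -meanD; apply: eq_mean => s.
by field.
Qed.

Lemma mean_signed_sum_exp4 u r : uniq r ->
  mean (fun s => signed_sum u r s ^+ 4) <= 3 * (\sum_(i <- r) u i ^+ 2) ^+ 2.
Proof.
elim: r => [_|j r IHr /= /andP[jr ur]].
  under eq_mean do rewrite signed_sum_nil.
  by rewrite big_nil mean_cst ?card_cube_gt0 // !expr0n mulr0.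
rewrite (mean_signed_sum_cons (fun x => x ^+ 4)) // big_cons.
have -> : mean (fun s => ((signed_sum u r s + u j) ^+ 4 +
      (signed_sum u r s - u j) ^+ 4) / 2) =
    mean (fun s => signed_sum u r s ^+ 4) +
    6 * u j ^+ 2 * mean (fun s => signed_sum u r s ^+ 2) + u j ^+ 4.
  rewrite -[u j ^+ 4](mean_cst _ card_cube_gt0) -meanZ -!meanD.
  by apply: eq_mean => s; field.
rewrite mean_signed_sum_sqr //; have := IHr ur.
set q := \sum_(i <- r) _; have : 0 <= u j ^+ 4 by rewrite exprn_even_ge0.
by nra.
Qed.

Lemma expR_le_invsqrt (b : R) : b < 1 -> expR (b / 2) <= (Num.sqrt (1 - b))^-1.
Proof.
move=> b1; rewrite -[b / 2]opprK expRN.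
rewrite lef_pV2 ?posrE ?expR_gt0 ?sqrtr_gt0 ?subr_gt0 //.
rewrite -(ger0_norm (expR_ge0 (- (b / 2)))) -sqrtr_sqr ler_wsqrtr //.
rewrite -expRM_natl; have -> : 2 * - (b / 2) = - b by field.
exact: expR_ge1Dx.
Qed.

(** The case of a single sign, compared with E exp(a (x + v g)^2) for a standard
    Gaussian g, which is exactly the right-hand side. The cross term is bounded
    by [cosh_le_expR]; the remaining loss is covered by
    exp(b/2) <= (1-b)^(-1/2) and 1+b <= 1/(1-b), where b = 2 a v^2. *)
Lemma signed_step_mgf (a x v : R) : 0 <= a -> 2 * a * v ^+ 2 < 1 ->
  (expR (a * (x + v) ^+ 2) + expR (a * (x - v) ^+ 2)) / 2 <=
  (Num.sqrt (1 - 2 * a * v ^+ 2))^-1 *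
  expR (a / (1 - 2 * a * v ^+ 2) * x ^+ 2).
Proof.
move=> a0; set b := 2 * a * v ^+ 2 => b1.
have b0 : 0 <= b by rewrite /b mulr_ge0 ?sqr_ge0 // mulr_ge0.
pose y := 2 * a * x * v.
have E (t : R) : t ^+ 2 = 1 -> expR (a * (x + t * v) ^+ 2) =
    expR (b / 2) * expR (a * x ^+ 2) * expR (t * y).
  move=> t2; rewrite -!expRD; congr expR.
  have -> : a * (x + t * v) ^+ 2 =
     a * x ^+ 2 + 2 * a * x * t * v + a * t ^+ 2 * v ^+ 2 by ring.
  by rewrite t2 /b /y; field.
have := E 1 (expr1n _ _); have := E (-1) (etrans (sqrrN _) (expr1n _ _)).
rewrite !mul1r !mulN1r => -> ->.
have axb : a * x ^+ 2 + y ^+ 2 / 2 <= a / (1 - b) * x ^+ 2.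
  have -> : a * x ^+ 2 + y ^+ 2 / 2 = a * x ^+ 2 * (1 + b).
    by rewrite /y /b; field.
  rewrite [leRHS]mulrAC ler_wpM2l //; first by rewrite mulr_ge0 ?sqr_ge0.
  by rewrite -[leRHS]mul1r ler_pdivlMr ?subr_gt0 //; nra.
apply: (@le_trans _ _ (expR (b / 2) * (expR (a * x ^+ 2 + y ^+ 2 / 2)))).
  have := cosh_le_expR y; rewrite expRD.
  have : 0 <= expR (b / 2) * expR (a * x ^+ 2) by rewrite mulr_ge0 ?expR_ge0.
  by nra.
by apply: ler_pM; rewrite ?expR_ge0 ?ler_expR ?expR_le_invsqrt.
Qed.

(** Averaging out the sign s j turns a into a/(1-b), b = 2 a (u j)^2, and the
    prefactors (1-b)^(-1/2) multiply up exactly as for independent Gaussians. *)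
Lemma mgf_signed_sum_sqr u r (a : R) : uniq r -> 0 <= a ->
  2 * a * \sum_(i <- r) u i ^+ 2 < 1 ->
  mean (fun s => expR (a * signed_sum u r s ^+ 2)) <=
  (Num.sqrt (1 - 2 * a * \sum_(i <- r) u i ^+ 2))^-1.
Proof.
elim: r a => [|j r IHr] a /=.
  under eq_mean do rewrite signed_sum_nil expr0n mulr0 expR0.
  by rewrite big_nil mulr0 subr0 sqrtr1 invr1 mean_cst ?card_cube_gt0.
move=> /andP[jr ur] a0; rewrite big_cons; set q := \sum_(i <- r) _ => as1.
have q0 : 0 <= q by apply: sumr_ge0 => i _; exact: sqr_ge0.
have b1 : 2 * a * u j ^+ 2 < 1.
  by apply: le_lt_trans as1; rewrite ler_wpM2l ?mulr_ge0 // lerDl.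
rewrite (mean_signed_sum_cons (fun x => expR (a * x ^+ 2))) //.
apply: (le_trans (ler_mean (fun s =>
  signed_step_mgf (signed_sum u r s) a0 b1))).
set b := 2 * a * u j ^+ 2 in b1 *.
have nb0 : 0 < 1 - b by rewrite subr_gt0.
have bE : 2 * (a / (1 - b)) * q = 2 * a * q / (1 - b) by field; rewrite gt_eqF.
rewrite meanZ mulrDr -/b opprD addrA in as1 *.
have -> : 1 - b - 2 * a * q = (1 - b) * (1 - 2 * (a / (1 - b)) * q).
  by field; rewrite gt_eqF.
rewrite sqrtrM ?(ltW nb0) // invfM ler_wpM2l ?invr_ge0 ?sqrtr_ge0 //.
apply: IHr => //; first by rewrite divr_ge0 // ltW.
by rewrite bE ltr_pdivrMr // mul1r ltrBrDl.
Qed.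

End Cube.

(** * Positive semi-definite matrices as sums of outer products *)

Section Forms.
Variables (R : realType) (n : nat).
Implicit Types (A B : 'M[R]_n) (x y v : 'cV[R]_n).

Definition bform A x y : R := (x^T *m A *m y) 0 0.

Lemma bformDl A x1 x2 y : bform A (x1 + x2) y = bform A x1 y + bform A x2 y.
Proof. by rewrite /bform linearD /= !mulmxDl mxE. Qed.

Lemma bformZl A (a : R) x y : bform A (a *: x) y = a * bform A x y.
Proof. by rewrite /bform linearZ /= -!scalemxAl mxE. Qed.

Lemma bformC A x y : A^T = A -> bform A x y = bform A y x.
Proof.
move=> As; rewrite /bform; have -> : y^T *m A *m x = (x^T *m A *m y)^T.
  by rewrite !trmx_mul trmxK As mulmxA.
by rewrite [RHS]mxE.
Qed.

Lemma bform_delta A i j : bform A (delta_mx i 0) (delta_mx j 0) = A i j.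
Proof. by rewrite /bform trmx_delta -rowE -colE !mxE. Qed.

Lemma bform_deltal A i x : bform A (delta_mx i 0) x = \sum_j A i j * x j 0.
Proof.
by rewrite /bform trmx_delta -rowE mxE; apply: eq_bigr => j _; rewrite mxE.
Qed.

Lemma bform_comb A (t : R) x y : A^T = A ->
  bform A (x + t *: y) (x + t *: y) =
  bform A x x + 2 * t * bform A y x + t ^+ 2 * bform A y y.
Proof.
move=> As; rewrite bformDl bformZl !(bformC _ (x + _)) // !bformDl !bformZl.
by rewrite (bformC x y As); ring.
Qed.

Lemma bformB A B x y : bform (A - B) x y = bform A x y - bform B x y.
Proof. by rewrite /bform mulmxBr mulmxBl !mxE. Qed.

Lemma bform_sum (s : seq 'cV[R]_n) (F : 'cV[R]_n -> 'M[R]_n) x y :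
  bform (\sum_(v <- s) F v) x y = \sum_(v <- s) bform (F v) x y.
Proof. by rewrite /bform mulmx_sumr mulmx_suml summxE. Qed.

Lemma bform_outer v x : bform (v *m v^T) x x = (\sum_j v j 0 * x j 0) ^+ 2.
Proof.
rewrite /bform mulmxA -mulmxA mxE big_ord1 expr2; congr (_ * _).
  by rewrite mxE; apply: eq_bigr => j _; rewrite mxE mulrC.
by rewrite mxE; apply: eq_bigr => j _; rewrite mxE.
Qed.

Lemma trace_outer v : \tr (v *m v^T) = \sum_j v j 0 ^+ 2.
Proof.
by apply: eq_bigr => j _; rewrite mxE big_ord1 mxE expr2.
Qed.

Lemma psd_diag_ge0 A i : psdmx A -> 0 <= A i i.
Proof.
by case=> _ /(_ (delta_mx i 0)); rewrite -/(bform _ _ _) bform_delta.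
Qed.

Lemma psd_diag0 A : psdmx A -> (forall i, A i i = 0) -> A = 0.
Proof.
move=> [As Ap] A0; apply/matrixP => i j; rewrite mxE.
have H t : 0 <= 2 * t * A j i.
  have := Ap (delta_mx i 0 + t *: delta_mx j 0).
  by rewrite -/(bform _ _ _) bform_comb // !bform_delta !A0 mulr0 addr0 add0r.
have -> : A i j = A j i by rewrite -[in LHS]As mxE.
by have := H 1; have := H (-1); lra.
Qed.

(** One elimination step: v is column i of A divided by the square root of
    A i i, and A - v v^T stays positive semi-definite by the Cauchy-Schwarz
    inequality for the form of A. Diagonal zeros are kept and one is gained, so
    the number of nonzero diagonal entries decreases. *)
Lemma psd_peel A i : psdmx A -> A i i != 0 ->
  exists v, [/\ psdmx (A - v *m v^T), (A - v *m v^T) i i = 0 &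
    forall k, A k k = 0 -> (A - v *m v^T) k k = 0].
Proof.
move=> Apsd Aii; have [As Ap] := Apsd.
have a0 : 0 < A i i by rewrite lt_def Aii psd_diag_ge0.
have sqa : Num.sqrt (A i i) ^+ 2 = A i i by rewrite sqr_sqrtr // ltW.
have sa0 : Num.sqrt (A i i) != 0 by rewrite gt_eqF // sqrtr_gt0.
pose v := (Num.sqrt (A i i))^-1 *: col i A.
have vE k : v k 0 = (Num.sqrt (A i i))^-1 * A i k.
  by rewrite !mxE; congr (_ * _); rewrite -[in LHS]As mxE.
have BE k : (A - v *m v^T) k k = A k k - A i k ^+ 2 / A i i.
  rewrite !mxE big_ord1 [v^T _ _]mxE vE -expr2 exprMn exprVn sqa.
  by rewrite mulrC.
have Bpsd : psdmx (A - v *m v^T).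
  split; first by rewrite linearB /= trmx_mul trmxK As.
  move=> x; rewrite -/(bform _ _ _) bformB bform_outer.
  have -> : \sum_j v j 0 * x j 0 =
      (Num.sqrt (A i i))^-1 * bform A (delta_mx i 0) x.
    rewrite bform_deltal mulr_sumr; apply: eq_bigr => j _.
    by rewrite vE mulrA.
  (* this point minimises the form of A on the line x + R e_i *)
  have := Ap (x + (- (bform A (delta_mx i 0) x / A i i)) *: delta_mx i 0).
  rewrite -/(bform _ _ _) bform_comb // bform_delta exprMn exprVn sqa.
  congr (0 <= _); field; exact: Aii.
exists v; split=> //; first by rewrite BE; field.
move=> k Ak; apply/eqP; rewrite eq_le psd_diag_ge0 // BE Ak.
by rewrite sub0r oppr_le0 divr_ge0 ?sqr_ge0 ?ltW.
Qed.

Lemma psd_sum_outer A : psdmx A ->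
  exists s : seq 'cV[R]_n, A = \sum_(v <- s) v *m v^T.
Proof.
have [m] := ubnP #|[pred i | A i i != 0]|; elim: m A => // m IHm A Am Apsd.
case: (pickP (fun i => A i i != 0)) => [i Aii|A0]; last first.
  exists [::]; rewrite big_nil; apply: psd_diag0 => // i.
  by apply/eqP; have := A0 i; case: eqP.
have [v [Bpsd Bi Bk]] := psd_peel Apsd Aii.
have [|s sE] := IHm _ _ Bpsd; last first.
  by exists (v :: s); rewrite big_cons -sE addrC subrK.
rewrite -ltnS; apply: leq_trans Am; rewrite ltnS; apply: proper_card.
apply/properP; split.
  by apply/fintype.subsetP => k; rewrite !inE; apply: contra => /eqP /Bk ->.
by exists i; rewrite !inE // Bi eqxx.
Qed.

End Forms.

(** * Jensen and Chernoff bounds *)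

(** Weighted sum of the tangent inequalities
    exp (t i) >= exp m (1 + t i - m) at the barycentre m. *)
Lemma expR_jensen (R : realType) (I : Type) (r : seq I) (p t : I -> R) :
  (forall i, 0 <= p i) -> \sum_(i <- r) p i = 1 ->
  expR (\sum_(i <- r) p i * t i) <= \sum_(i <- r) p i * expR (t i).
Proof.
move=> p0 p1; set m := \sum_(i <- r) p i * t i.
have -> : expR m = \sum_(i <- r) p i * (expR m * (1 + (t i - m))).
  under eq_bigr do rewrite mulrCA mulrDr mulr1 mulrBr.
  rewrite -mulr_sumr big_split /= sumrB -mulr_suml p1 mul1r subrr.
  by rewrite addr0 mulr1.
apply: ler_sum => i _; apply: ler_wpM2l => //.
have -> : t i = m + (t i - m) by ring.
rewrite [leRHS]expRD (_ : m + _ - m = t i - m); last by ring.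
by rewrite ler_wpM2l ?expR_ge0 // expR_ge1Dx.
Qed.

Section Chernoff.
Variables (R : realType) (S : finType).

(** Independence of the rows of a uniform element of the power of [S]. *)
Lemma mean_prod N (f : S -> R) :
  mean (fun s : {ffun 'I_N -> S} => \prod_i f (s i)) = mean f ^+ N.
Proof.
rewrite /mean card_ffun card_ord natrX exprMn exprVn; congr (_ * _).
by rewrite -(bigA_distr_bigA (fun _ => f)) prodr_const card_ord.
Qed.

(** A threshold c for the average is covered by taking f = h (X - c). *)
Lemma chernoff N (f : S -> R) :
  mean (fun s : {ffun 'I_N -> S} => (0 <= \sum_i f (s i))%R%:R) <=
  mean (fun x => expR (f x)) ^+ N.
Proof.
rewrite -mean_prod; apply: ler_mean => s; rewrite -expR_sum.
have [h|_] := lerP 0 (\sum_i f (s i)); last exact: expR_ge0.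
by apply: le_trans (expR_ge1Dx _); rewrite lerDl.
Qed.

End Chernoff.

(** * Exponential moments of the quadratic form *)

Section Quadratic.
Variables (R : realType) (n : nat).
Implicit Types (A : 'M[R]_n) (s : {ffun 'I_n -> bool}).

Definition sign_vector s : 'cV[R]_n := \col_j (-1) ^+ s j.

Definition ratio A s : R := bform A (sign_vector s) (sign_vector s) / \tr A.

Let U (u : 'I_n -> R) s := signed_sum u (index_enum 'I_n) s.

(** Reduction from a positive semi-definite matrix to a single linear form, by
    convexity of exp; the division by the squared norm of u replaces
    normalising u. *)
Lemma mgf_ratio A (c C : R) : psdmx A -> 0 < \tr A ->
  (forall u : 'I_n -> R, 0 < \sum_i u i ^+ 2 ->
    mean (fun s => expR (c * (U u s ^+ 2 / \sum_i u i ^+ 2))) <= C) ->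
  mean (fun s => expR (c * ratio A s)) <= C.
Proof.
move=> Apsd tA uC; have [vs AE] := psd_sum_outer Apsd.
pose nv (v : 'cV[R]_n) := \sum_j v j 0 ^+ 2.
have nv0 v : 0 <= nv v by apply: sumr_ge0 => j _; exact: sqr_ge0.
have trE : \tr A = \sum_(v <- vs) nv v.
  by rewrite AE raddf_sum; apply: eq_bigr => v _; rewrite /= trace_outer.
pose p v := nv v / \tr A.
have p0 v : 0 <= p v by rewrite divr_ge0 // ltW.
have p1 : \sum_(v <- vs) p v = 1.
  by rewrite -mulr_suml -trE divff // gt_eqF.
pose q (v : 'cV[R]_n) s := U (fun j => v j 0) s ^+ 2 / nv v.
have rE s : c * ratio A s = \sum_(v <- vs) p v * (c * q v s).
  rewrite /ratio {1}AE bform_sum mulr_suml mulr_sumr; apply: eq_bigr => v _.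
  rewrite bform_outer.
  have -> : \sum_j v j 0 * sign_vector s j 0 = U (fun j => v j 0) s.
    by apply: eq_bigr => j _; rewrite mxE.
  (* a vector v = 0 has weight 0, and its quotient q v is the junk value 0/0 *)
  have [v0|nv_neq0] := eqVneq (nv v) 0; last first.
    by rewrite /p /q; field; rewrite nv_neq0 gt_eqF.
  rewrite /p v0 !mul0r (_ : U _ _ = 0) ?expr0n /= ?mul0r ?mulr0 //.
  apply: big1 => j _; have /eqP := v0.
  rewrite psumr_eq0 => [|? _]; last exact: sqr_ge0.
  move=> /allP /(_ j (mem_index_enum _)).
  by rewrite sqrf_eq0 => /eqP ->; rewrite mul0r.
under eq_mean do rewrite rE.
apply: le_trans (ler_mean (fun s => expR_jensen _ p0 p1)) _.
rewrite mean_sum -[C]mul1r -p1 mulr_suml; apply: ler_sum => v _.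
rewrite meanZ; have [v0|nv_neq0] := eqVneq (nv v) 0.
  by rewrite /p v0 !mul0r.
by apply: ler_wpM2l => //; apply: uC; rewrite -/(nv v) lt_def nv_neq0 nv0.
Qed.

Lemma mgf_ratio_pos A (h : R) : psdmx A -> 0 < \tr A -> 0 <= h -> h < 1 / 2 ->
  mean (fun s => expR (h * ratio A s)) <= (Num.sqrt (1 - 2 * h))^-1.
Proof.
move=> Apsd tA h0 h1; apply: mgf_ratio => // u u0.
set S := \sum_i _ in u0 *.
have hE : 2 * (h / S) * S = 2 * h by field; rewrite gt_eqF.
have := @mgf_signed_sum_sqr R _ u (index_enum 'I_n) (h / S) (index_enum_uniq _).
rewrite -/S hE => H.
under eq_mean do rewrite mulrCA mulrC.
by apply: H; [rewrite divr_ge0 // ltW|lra].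
Qed.

Lemma mgf_ratio_neg A (h : R) : psdmx A -> 0 < \tr A -> 0 <= h ->
  mean (fun s => expR (- h * ratio A s)) <= expR (- h + 3 * h ^+ 2 / 2).
Proof.
move=> Apsd tA h0; apply: mgf_ratio => // u u0.
set S := \sum_i _ in u0 *.
have q s : expR (- h * (U u s ^+ 2 / S)) <=
    1 + (- h / S * U u s ^+ 2 + h ^+ 2 / S ^+ 2 / 2 * U u s ^+ 4).
  have x0 : 0 <= h * (U u s ^+ 2 / S).
    by rewrite mulr_ge0 // divr_ge0 ?sqr_ge0 // ltW.
  rewrite mulNr; apply: le_trans (expRN_le_quadratic x0) _.
  by rewrite le_eqVlt; apply/orP; left; apply/eqP; field; rewrite gt_eqF.
apply: le_trans (ler_mean q) _.
rewrite meanD mean_cst ?card_cube_gt0 // meanD !meanZ.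
rewrite mean_signed_sum_sqr ?index_enum_uniq // -/S.
have := mean_signed_sum_exp4 u (index_enum_uniq 'I_n); rewrite -/S => m4.
apply: le_trans (expR_ge1Dx _); rewrite lerD2l.
have -> : - h / S * S = - h by field; rewrite gt_eqF.
rewrite lerD2l.
have -> : 3 * h ^+ 2 / 2 = h ^+ 2 / S ^+ 2 / 2 * (3 * S ^+ 2).
  by field; rewrite gt_eqF.
by apply: ler_wpM2l => //; rewrite !divr_ge0 ?sqr_ge0.
Qed.

(** The factor h = e/(2(1+e)) minimises exp(-h(1+e)) / sqrt(1-2h), the bound
    given by [mgf_ratio_pos]; the minimum is sqrt(1+e) exp(-e/2). *)
Lemma upper_tail_mgf A (e : R) : psdmx A -> 0 < \tr A -> 0 <= e -> e <= 3 / 4 ->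
  mean (fun s => expR (e / (2 * (1 + e)) * (ratio A s - (1 + e))))
    <= expR (- (e ^+ 2 / 6)).
Proof.
move=> Apsd tA e0 e1; have e10 : 0 < 1 + e by lra.
set h := e / _.
have h0 : 0 <= h by rewrite divr_ge0 //; lra.
have h12 : 1 - 2 * h = (1 + e)^-1 by rewrite /h; field; rewrite gt_eqF.
have h1 : h < 1 / 2.
  by have : 0 < (1 + e)^-1 by [rewrite invr_gt0]; lra.
have -> : mean (fun s => expR (h * (ratio A s - (1 + e)))) =
    expR (- (e / 2)) * mean (fun s => expR (h * ratio A s)).
  rewrite -meanZ; apply: eq_mean => s; rewrite -expRD; congr expR.
  by rewrite /h; field; rewrite gt_eqF.
apply: le_trans (_ : expR (- (e / 2)) * Num.sqrt (1 + e) <= _).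
  rewrite ler_wpM2l ?expR_ge0 //.
  apply: le_trans (mgf_ratio_pos Apsd tA h0 h1) _.
  by rewrite h12 sqrtrV ?invrK // ltW.
have -> : - (e ^+ 2 / 6) = - (e / 2) + (e - e ^+ 2 / 3) / 2 by field.
rewrite expRD ler_wpM2l ?expR_ge0 //.
rewrite -[leRHS](ger0_norm (expR_ge0 _)) -sqrtr_sqr ler_wsqrtr //.
rewrite -expRM_natl (_ : 2%:R * _ = e - e ^+ 2 / 3); last by field.
exact: onePx_le_expR.
Qed.

(** The factor h = e/3 minimises the exponent -h e + 3h^2/2 that results from
    [mgf_ratio_neg]. *)
Lemma lower_tail_mgf A (e : R) : psdmx A -> 0 < \tr A -> 0 <= e ->
  mean (fun s => expR (e / 3 * ((1 - e) - ratio A s)))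
    <= expR (- (e ^+ 2 / 6)).
Proof.
move=> Apsd tA e0; set h := e / 3.
have h0 : 0 <= h by rewrite divr_ge0.
have -> : mean (fun s => expR (h * ((1 - e) - ratio A s))) =
    expR (h * (1 - e)) * mean (fun s => expR (- h * ratio A s)).
  by rewrite -meanZ; apply: eq_mean => s; rewrite -expRD; congr expR; ring.
have -> : - (e ^+ 2 / 6) = h * (1 - e) + (- h + 3 * h ^+ 2 / 2).
  by rewrite /h; field.
by rewrite expRD ler_wpM2l ?expR_ge0 // mgf_ratio_neg.
Qed.

End Quadratic.

(** * The distribution of a Rademacher sample *)

Section Sample.
Variables (R : realType) (d : measure_display) (T : measurableType d).
Variables (P : probability T R) (n N : nat).
Variable w : 'I_N -> 'I_n -> {RV P >-> R}.

Definition sign_matrix := {ffun 'I_N -> {ffun 'I_n -> bool}}.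
Implicit Types s : sign_matrix.

Definition row_event i (r : {ffun 'I_n -> bool}) : set T :=
  \bigcap_(j in [set` [set: 'I_n]%SET]) w i j @^-1` [set (-1) ^+ r j].

Definition sample_event s : set T :=
  \bigcap_(i in [set` [set: 'I_N]%SET]) row_event i (s i).

Lemma row_eventE i (r : {ffun 'I_n -> bool}) x :
  row_event i r x <-> forall j, w i j x = (-1) ^+ r j.
Proof.
split=> [rx j|rx j _]; last exact: rx.
by apply: (rx j); rewrite /= inE.
Qed.

Lemma sample_eventP s x i : sample_event s x ->
  sample_vector w i x = sign_vector R (s i).
Proof.
move=> /(_ i); rewrite /= inE => /(_ isT)/row_eventE rx.
by apply/matrixP => j k; rewrite !mxE.
Qed.

(** Independence of the rows is a statement about the sigma-algebras that they
    generate, so the row events have to be located there. *)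
Lemma row_event_sigma i r :
  g_sigma_preimage (fun j => w i j : T -> R) (row_event i r).
Proof.
rewrite /g_sigma_preimage; set G := \big[_/_]_(_ < _) _.
have := @fin_bigcap_measurable _ (g_sigma_algebraType G) 'I_n
  [set` [set: 'I_n]%SET] (fun j => w i j @^-1` [set (-1) ^+ r j]).
apply=> // j _; apply: sub_sigma_algebra; rewrite /G.
rewrite (bigD1 j) //=; left; exists [set (-1) ^+ r j] => //.
by rewrite setTI.
Qed.

Lemma measurable_row_event i r : measurable (row_event i r).
Proof.
by apply: fin_bigcap_measurable => // j _; rewrite -[X in measurable X]setTI;
  exact: measurable_funP.
Qed.

Lemma measurable_sample_event s : measurable (sample_event s).
Proof.
by apply: fin_bigcap_measurable => // i _; exact: measurable_row_event.
Qed.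

Lemma trivIset_sample_event : trivIset setT sample_event.
Proof.
move=> s1 s2 _ _ [x [sx1 sx2]]; apply/ffunP => i; apply/ffunP => j.
have := sample_eventP i sx1; rewrite (sample_eventP i sx2).
move=> /matrixP /(_ j ord0).
by rewrite !mxE => /eqP; rewrite (inj_eq (@signr_inj _)) => /eqP.
Qed.

Hypothesis w_sample : rademacher_sample w.

Lemma probability_sample_event s :
  P (sample_event s) = (#|{: sign_matrix}|%:R^-1)%:E.
Proof.
have [indep_rows indep_entries w_rad] := w_sample.
rewrite indep_rows => [|i _]; last exact: row_event_sigma.
have rowP i : P (row_event i (s i)) = (2^-1 ^+ n)%:E.
  rewrite (indep_entries i) => [|j _]; last first.
    by exists [set (-1) ^+ s i j]; rewrite ?setTI.
  rewrite (eq_bigr (fun _ => (2^-1 : R)%:E)) => [|j _].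
    by rewrite prodEFin prodr_const cardsT card_ord.
  by have [] := w_rad i j; case: (s i j).
under eq_bigr do rewrite rowP.
rewrite prodEFin prodr_const cardsT card_ord.
by rewrite !card_ffun !card_ord card_bool !natrX !exprVn.
Qed.

(** The sample events exhaust the space up to the null set where some entry is
    not a sign; that set can only help a lower bound. *)
Lemma probability_ge_mean (good : pred sign_matrix) (E : set T) :
  measurable E -> (forall s, good s -> sample_event s `<=` E) ->
  ((mean (fun s => (good s)%:R : R))%:E <= P E)%E.
Proof.
move=> mE goodE.
pose r := [seq s <- index_enum sign_matrix | good s].
have ur : uniq r by rewrite filter_uniq // index_enum_uniq.
have -> : (mean (fun s => (good s)%:R : R))%:E =
    P (\bigcup_(s in [set` r]) sample_event s).
  rewrite measure_fin_bigcup //; first last.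
  - by move=> s _; exact: measurable_sample_event.
  - exact: sub_trivIset trivIset_sample_event.
  rewrite -fsbig_seq //.
  rewrite (eq_bigr (fun _ => (#|{: sign_matrix}|%:R^-1)%:E)) => [|s _];
    last first.
    exact: probability_sample_event.
  rewrite big_filter sumEFin /mean mulr_sumr; congr EFin.
  rewrite [RHS]big_mkcond.
  by apply: eq_bigr => s _; case: (good s); rewrite ?mulr1 ?mulr0.
rewrite le_measure ?inE //.
  apply: fin_bigcup_measurable => [|s _]; first exact: finite_finset.
  exact: measurable_sample_event.
by move=> x [s /=]; rewrite mem_filter => /andP[/goodE sE _] /sE.
Qed.

Lemma measurable_hutchinson (A : 'M[R]_n) :
  measurable_fun setT (hutchinson w A).
Proof.
apply: measurable_funM => //; apply: measurable_sum => i.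
under eq_fun do rewrite mxE.
apply: measurable_sum => k; apply: measurable_funM.
  under eq_fun do rewrite mxE.
  apply: measurable_sum => j; under eq_fun do rewrite !mxE.
  by apply: measurable_funM.
under eq_fun do rewrite mxE.
exact: measurable_funP.
Qed.

End Sample.

(** * Concentration *)

(** A sign matrix violating the estimate lies in one of two Chernoff tails, each
    of mean at most delta/2. *)
Lemma concentration_on_sign_matrices (R : realType) (n N : nat)
    (A : 'M[R]_n) (eps delta : R) :
  psdmx A -> 0 < eps -> eps <= 3 / 4 -> 0 < delta -> delta < 1 ->
  6 * sample_bound eps delta <= N%:R ->
  1 - delta <= mean (fun s : sign_matrix n N =>
    (`|N%:R^-1 *
       \sum_(i < N) bform A (sign_vector R (s i)) (sign_vector R (s i)) -
       \tr A| <= eps * \tr A)%R%:R : R).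
Proof.
move=> Apsd e0 e1 d0 d1 Nge.
have O0 : (0 < #|{: sign_matrix n N}|)%N.
  by apply/card_gt0P; exists [ffun=> [ffun=> false]].
(* if tr A = 0 then A = 0 and both sides of the estimate vanish *)
have [A0|tA0] := eqVneq (\tr A) 0.
  have {}A0 : A = 0.
    apply: psd_diag0 => // i; move/eqP: A0.
    rewrite psumr_eq0 => [|j _]; last exact: psd_diag_ge0.
    by move=> /allP /(_ i (mem_index_enum _)) /eqP.
  rewrite (eq_mean (g := fun=> 1)) => [|s]; first by rewrite mean_cst //; lra.
  rewrite big1 => [|i _]; last by rewrite A0 /bform mulmx0 mul0mx mxE.
  by rewrite A0 linear0 !mulr0 subr0 normr0 lexx.
have tA : 0 < \tr A.
  by rewrite lt_def tA0 sumr_ge0 // => i _; exact: psd_diag_ge0.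
have L0 : 0 < ln (2 / delta) by rewrite ln_gt0 // ltr_pdivlMr //; lra.
have N0 : 0 < N%:R :> R.
  apply: lt_le_trans Nge.
  by rewrite /sample_bound !mulr_gt0 // invr_gt0 exprn_gt0.
have tail (f : {ffun 'I_n -> bool} -> R) :
    mean (fun s => expR (f s)) <= expR (- (eps ^+ 2 / 6)) ->
    mean (fun s : sign_matrix n N => (0 <= \sum_i f (s i))%R%:R) <= delta / 2.
  move=> fle; apply: le_trans (chernoff N f) _.
  apply: le_trans (_ : expR (- (eps ^+ 2 / 6)) ^+ N <= _).
    apply: lerXn2r fle; rewrite nnegrE ?expR_ge0 //.
    by rewrite mulr_ge0 ?invr_ge0 // sumr_ge0 // => s _; exact: expR_ge0.
  have -> : delta / 2 = expR (- ln (2 / delta)).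
    by rewrite expRN lnK ?invf_div // posrE divr_gt0.
  rewrite -expRM_natl ler_expR mulrN lerN2.
  have -> : ln (2 / delta) = 6 * sample_bound eps delta * (eps ^+ 2 / 6).
    by rewrite /sample_bound; field; rewrite gt_eqF.
  by rewrite ler_wpM2r // divr_ge0 ?sqr_ge0.
have up := tail _ (upper_tail_mgf Apsd tA (ltW e0) e1).
have lo := tail _ (lower_tail_mgf Apsd tA (ltW e0)).
set good := fun s => _.
set ups := fun s => _ in up; set los := fun s => _ in lo.
suff H : forall s, 1 <= good s + (ups s + los s).
  have := ler_mean H; rewrite mean_cst // !meanD; lra.
move=> s; rewrite /good.
set Q := \sum_(i < N) bform _ _ _.
have rE : \sum_(i < N) ratio A (s i) = Q / \tr A by rewrite mulr_suml.
have [_|bad] := lerP `|N%:R^-1 * Q - \tr A| (eps * \tr A).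
  by rewrite lerDl addr_ge0 // /ups /los ler0n.
rewrite add0r.
have upE : ups s =
    (0 <= eps / (2 * (1 + eps)) * (Q / \tr A - N%:R * (1 + eps)))%R%:R.
  by rewrite /ups -mulr_sumr sumrB rE sumr_const card_ord -[_ *+ N]mulr_natl.
have loE : los s = (0 <= eps / 3 * (N%:R * (1 - eps) - Q / \tr A))%R%:R.
  by rewrite /los -mulr_sumr sumrB rE sumr_const card_ord -[_ *+ N]mulr_natl.
have [pos|neg] := leP (\tr A) (N%:R^-1 * Q).
  suff -> : ups s = 1 by rewrite lerDl /los ler0n.
  rewrite upE; case: (boolP (0 <= _)) => // /negP[].
  apply: mulr_ge0; first by rewrite divr_ge0 // ?ltW //; lra.
  rewrite subr_ge0 ler_pdivlMr // -mulrA -ler_pdivlMl //.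
  by move: bad; rewrite ger0_norm ?subr_ge0 //; lra.
suff -> : los s = 1 by rewrite lerDr /ups ler0n.
rewrite loE; case: (boolP (0 <= _)) => // /negP[].
apply: mulr_ge0; first by rewrite divr_ge0 // ltW.
rewrite subr_ge0 ler_pdivrMr // -mulrA -ler_pdivrMl //.
by move: bad; rewrite ltr0_norm ?subr_lt0 //; lra.
Qed.

Theorem theorem1 (R : realType) (d : measure_display) (T : measurableType d)
    (P : probability T R) (n N : nat) (w : 'I_N -> 'I_n -> {RV P >-> R})
    (A : 'M[R]_n) (eps delta : R) :
  psdmx A ->
  rademacher_sample w ->
  0 < eps -> eps <= 3 / 4 ->
  0 < delta -> delta < 1 ->
  6 * sample_bound eps delta <= N%:R ->
  ((1 - delta)%:E <=
    P [set x | (`|hutchinson w A x - \tr A| <= eps * \tr A)%R])%E.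
Proof.
move=> Apsd wr e0 e1 d0 d1 Nge.
have := concentration_on_sign_matrices Apsd e0 e1 d0 d1 Nge.
rewrite -lee_fin => /le_trans; apply.
apply: (probability_ge_mean wr).
  rewrite -[X in measurable X]setTI; apply: measurable_fun_le => //.
  apply: measurableT_comp => //; apply: measurable_funB => //.
  exact: measurable_hutchinson.
move=> s good x sx /=; move: good.
congr (`|_ * _ - _| <= _); apply: eq_bigr => i _.
by rewrite (sample_eventP i sx).
Qed.
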